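(* Let $G$ be a finite, simple, connected graph and let $T$ be a spanning tree of $G$. If the subgraph $G[L(T)]$ of $G$ induced by the set $L(T)$ of leaves of $T$ is $3$-connected, then $T$ is a Tutte tree of $G$.
   Context: $L(T)$ is the set of leaves of $T$, and $G[X]$ is the subgraph induced by $X$. A graph is $k$-connected if it has more than $k$ vertices and remains connected after deleting any fewer than $k$ vertices. For a subgraph $H$ of $G$, $G-H$ is the subgraph induced by $V(G)\setminus V(H)$. A path $P$ in $G$ is nonseparating if $G-P$ is connected (the null graph and the one-vertex graph count as connected). A Tutte tree of $G$ is a spanning tree $T$ of $G$ such that every path contained in $T$ is nonseparating in $G$. *)

(* Defs.v *)
From mathcomp Require Import all_boot.

Set Implicit Arguments.
Unset Strict Implicit.
Unset Printing Implicit Defensive.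

(* A finite simple graph is an adjacency relation on a
   finType V; a subgraph with the full vertex set is a smaller such relation. *)
Definition simple_graph (V : finType) (e : rel V) : Prop :=
  symmetric e /\ irreflexive e.

(* The induced subgraph on A is connected; this holds for #|A| <= 1, in
   particular the null graph counts as connected. *)
Definition connected_in (V : finType) (e : rel V) (A : {set V}) : Prop :=
  {in A &, forall x y, connect [rel u v in A | e u v] x y}.

Definition connected (V : finType) (e : rel V) : Prop :=
  connected_in e [set: V].

(* The induced subgraph on A is k-connected. *)
Definition k_connected_in (V : finType) (e : rel V) (k : nat) (A : {set V})
    : Prop :=
  k < #|A| /\
  forall S : {set V}, S \subset A -> #|S| < k -> connected_in e (A :\: S).

(* In a simple graph, a ucycle of size 2 is just an edge traversed back and
   forth, so the genuine cycles are the ucycles of size at least 3. *)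
Definition acyclic (V : finType) (e : rel V) : Prop :=
  forall c : seq V, 2 < size c -> ~ ucycle e c.

Definition is_tree (V : finType) (t : rel V) : Prop :=
  [/\ simple_graph t, connected t & acyclic t].

Definition spanning_tree (V : finType) (e t : rel V) : Prop :=
  subrel t e /\ is_tree t.

Definition leaves (V : finType) (t : rel V) : {set V} :=
  [set x | #|[set y | t x y]| == 1].

(* x :: p is the vertex sequence of a (nonempty) path, without repetition. *)
Definition graph_path (V : finType) (e : rel V) (x : V) (p : seq V) : bool :=
  path e x p && uniq (x :: p).

Definition nonseparating (V : finType) (e : rel V) (x : V) (p : seq V)
    : Prop :=
  connected_in e (~: [set z in x :: p]).

Definition tutte_tree (V : finType) (e t : rel V) : Prop :=
  spanning_tree e t /\
  forall (x : V) (p : seq V), graph_path t x p -> nonseparating e x p.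

(* Main.v *)
(* Only the ends of a path P of T can be leaves of T, so at most two leaves lie
   on P and the remaining leaves induce a connected subgraph of G - P.  Every
   vertex off P is joined to one of them inside T - P: grow a subtree A from P
   by absorbing a vertex x adjacent to A; x has only one neighbour in A, so
   unless x is a leaf it has another neighbour outside A to continue with. *)
Require Import Defs.
From mathcomp Require Import all_boot.

Set Implicit Arguments.
Unset Strict Implicit.
Unset Printing Implicit Defensive.

Section InducedConnectivity.

Variables (V : finType) (e : rel V).
Implicit Types (A B : {set V}) (x y z : V).

Lemma connect_in_sub (e' : rel V) A B x y :
  subrel e e' -> A \subset B ->
  connect [rel u v in A | e u v] x y -> connect [rel u v in B | e' u v] x y.
Proof.
move=> see' /subsetP sAB; apply: connect_sub => u v /= /andP[/andP[uA vA] euv].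
by apply: connect1; rewrite /= !sAB //= see'.
Qed.

Lemma connect_in_sym A : symmetric e -> connect_sym [rel u v in A | e u v].
Proof.
by move=> e_sym; apply: sym_connect_sym => u v /=; rewrite e_sym [(u \in A) && _]andbC.
Qed.

Lemma connected_in_from A y :
  symmetric e -> {in A, forall x, connect [rel u v in A | e u v] y x} ->
  connected_in e A.
Proof.
move=> e_sym yA u v /yA yu /yA; apply: connect_trans.
by rewrite connect_in_sym.
Qed.

Lemma connected_inU1 A x y :
  symmetric e -> connected_in e A -> y \in A -> e y x ->
  connected_in e (x |: A).
Proof.
move=> e_sym cA yA eyx; apply: (@connected_in_from _ y) => // z.
case/setU1P=> [->|zA]; first by apply: connect1; rewrite /= !inE eqxx yA orbT.
by apply: connect_in_sub (cA _ _ yA zA); rewrite ?subsetUr.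
Qed.

Lemma connected_in_path x p :
  symmetric e -> path e x p -> connected_in e [set z in x :: p].
Proof.
move=> e_sym; elim/last_ind: p => [_|p z IHp].
  by move=> u v; rewrite !inE => /eqP-> /eqP->; apply: connect0.
rewrite rcons_path => /andP[/IHp cp ez].
have -> : [set u in x :: rcons p z] = z |: [set u in x :: p].
  by apply/setP=> u; rewrite !inE mem_rcons inE orbCA.
by apply: connected_inU1 ez => //; rewrite inE mem_last.
Qed.

(** The edge from [u] to [v] is the last one by which a path from [y] to [x] leaves [A], so the rest
    of that path avoids [A]. *)
Lemma connect_exit A x y :
  y \in A -> x \notin A -> connect e y x ->
  exists u v, [/\ u \in A, v \notin A, e u v
    & connect [rel a b in ~: A | e a b] v x].
Proof.
move=> yA + /connectP[p yp xE]; rewrite {}xE.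
elim/last_ind: p yp => [_|p z IHp]; first by rewrite /= yA.
rewrite rcons_path last_rcons => /andP[yp ez] zA.
have [lA|lA] := boolP (last y p \in A); first by exists (last y p), z.
have [u [v [uA vA euv vl]]] := IHp yp lA; exists u, v; split=> //.
by apply: connect_trans vl (connect1 _); rewrite /= !inE lA zA.
Qed.

End InducedConnectivity.

Section Trees.

Variables (V : finType) (t : rel V).
Hypotheses (t_sym : symmetric t) (t_irr : irreflexive t) (t_acyclic : acyclic t).
Implicit Types (A : {set V}) (x y z : V).

(** Two distinct neighbours of [x] in [A] would be joined by a path inside [A], which [x] closes up
    to a cycle. *)
Lemma acyclic_neighbour_unique A x y z :
  connected_in t A -> x \notin A -> y \in A -> z \in A -> t x y -> t x z ->
  y = z.
Proof.
move=> cA xA yA zA txy txz; apply/eqP/negPn/negP => neq_yz.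
have /connectP[p0 p0P zE] := cA _ _ yA zA.
case/shortenP: p0P zE => p pP up _ zE.
(* Every edge of the path has both ends in [A], so the path misses [x]. *)
have pA : all [in A] p.
  elim: p y yA pP {txy neq_yz up zE} => //= b p IHp y yA /andP[/andP[/andP[_ bA] _]].
  by move=> /(IHp b bA) ->; rewrite bA.
have tp : path t y p by apply: sub_path pP => u v /andP[].
apply: (t_acyclic (c := x :: y :: p)).
  (* As [y] and [z] differ, [p] is nonempty, so the cycle has at least three vertices. *)
  by case: (p) zE neq_yz => //= ->; rewrite eqxx.
rewrite /ucycle (cons_uniq x) up andbT /= rcons_path txy tp -zE t_sym txz /=.
rewrite inE negb_or; apply/andP; split; first by apply: contraNneq xA => ->.
by apply: contra xA => /(allP pA).
Qed.

Lemma leafPn x y :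
  t x y -> x \notin leaves t -> exists2 z, t x z & z != y.
Proof.
move=> txy; rewrite inE (cardsD1 y) inE txy eqSS cards_eq0.
by case/set0Pn=> z; rewrite !inE => /andP[]; exists z.
Qed.

Lemma connect_leaf_adj A x y :
  connected_in t A -> y \in A -> x \notin A -> t y x ->
  exists z, [/\ z \in leaves t, z \notin A
    & connect [rel u v in ~: A | t u v] x z].
Proof.
have [n] := ubnP #|~: A|; elim: n A x y => // n IHn A x y ltAn cA yA xA tyx.
have [xL|xL] := boolP (x \in leaves t); first by exists x; split.
have txy : t x y by rewrite t_sym.
have [w txw neq_wy] := leafPn txy xL.
have wA : w \notin A.
  by apply: contra neq_wy => wA; rewrite (acyclic_neighbour_unique cA xA wA yA txw txy).
have wxA : w \notin x |: A.
  by rewrite !inE negb_or wA andbT; apply: contraTneq txw => ->; rewrite t_irr.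
have sCA : ~: (x |: A) \subset ~: A by rewrite setCS subsetUr.
(* The induction is on the size of [~: A], which shrinks when [x] is absorbed. A connection that
   avoids [x |: A] also avoids [A]. *)
have [|||z [zL zA wz]] := IHn (x |: A) w x _ _ _ wxA txw.
- apply: leq_trans (ltAn : #|~: A| <= n); apply: proper_card.
  apply/properP; split=> //; exists x; rewrite !inE ?eqxx //.
- exact: connected_inU1 tyx.
- by rewrite setU11.
exists z; split=> //; first by move: zA; rewrite !inE negb_or => /andP[].
apply: connect_trans (connect1 _) (connect_in_sub _ sCA wz) => //.
by rewrite /= !inE xA wA.
Qed.

(** Here [x] may be far from [A]: first go back, outside [A], to a vertex [v] adjacent to [A], and
    continue from there to a leaf. *)
Lemma connect_leaf A x y :
  connected t -> connected_in t A -> y \in A -> x \notin A ->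
  exists z, [/\ z \in leaves t, z \notin A
    & connect [rel u v in ~: A | t u v] x z].
Proof.
move=> ct cA yA xA.
have yx : connect t y x.
  by apply: connect_sub (ct y x _ _) => // u v /andP[_]; apply: connect1.
have [u [v [uA vA tuv vx]]] := connect_exit yA xA yx.
have [z [zL zA vz]] := connect_leaf_adj cA uA vA tuv.
exists z; split=> //; apply: connect_trans vz.
by rewrite connect_in_sym.
Qed.

(** An inner vertex has its predecessor and its successor on the path as neighbours; these are
    distinct, so it is no leaf. *)
Lemma leaf_on_path x p z :
  graph_path t x p -> z \in leaves t -> z \in x :: p ->
  z \in [set x; last x p].
Proof.
move=> /andP[xp up] zL; rewrite inE in_set2 => /predU1P[->|zp]; first by rewrite eqxx.
case/splitPr: zp xp up => p1 [|w p2]; first by rewrite last_cat /= eqxx orbT.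
rewrite cat_path -cat_cons cat_uniq => /and3P[_ tlz /andP[tzw _]] /and3P[_ + _].
move=> /hasPn/(_ w); rewrite !inE eqxx orbT => /(_ isT) /negP[].
(* If [z] is a leaf, its only neighbour [b] is both [w] and [last x p1], so [w] occurs twice on the
   path. *)
move: zL; rewrite inE => /cards1P[b /setP Nz].
have:= Nz w; have:= Nz (last x p1); rewrite !inE t_sym tlz tzw.
by move=> /esym/eqP lb /esym/eqP ->; rewrite -in_cons -lb mem_last.
Qed.

End Trees.

Theorem theorem2 (V : finType) (e t : rel V) :
  simple_graph e -> connected e -> spanning_tree e t ->
  k_connected_in e 3 (leaves t) ->
  tutte_tree e t.
Proof.
move=> [e_sym _] _ tree_t [_ L3]; split=> // x p tp.
have [ste [[t_sym t_irr] ct t_acyclic]] := tree_t.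
rewrite /nonseparating; set A := [set z in x :: p].
have cA : connected_in t A by apply: connected_in_path => //; case/andP: tp.
have xA : x \in A by rewrite inE mem_head.
pose S := leaves t :&: A.
have cLS : connected_in e (leaves t :\: S).
  apply: L3; first exact: subsetIl.
  (* The set of ends has one or two elements, according to whether they coincide; both are below
     3. *)
  apply: (@leq_ltn_trans #|[set x; last x p]|); last by rewrite cards2 ltnS; case: (_ != _).
  apply/subset_leq_card/subsetP=> z /setIP[zL]; rewrite inE.
  exact: (leaf_on_path t_sym tp).
have sLS : leaves t :\: S \subset ~: A.
  by apply/subsetP=> z; rewrite !inE => /andP[+ zL]; rewrite zL.
have to_leaf u : u \notin A -> exists2 z, z \in leaves t :\: S
    & connect [rel a b in ~: A | e a b] u z.
  move=> uA; have [z [zL zA uz]] := connect_leaf t_sym t_irr t_acyclic ct cA xA uA.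
  exists z; last exact: connect_in_sub uz.
  by rewrite in_setD in_setI zL zA.
move=> u v; rewrite !in_setC => /to_leaf[z zLS uz] /to_leaf[w wLS vw].
apply: connect_trans uz _.
apply: connect_trans (connect_in_sub _ sLS (cLS _ _ zLS wLS)) _ => //.
by rewrite connect_in_sym.
Qed.
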